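(* Let $x\in R(X^{-1},X^0)=\operatorname{Hom}_\Lambda(X^{-1},X^0)$ with associated object $X=(X^{-1}\xrightarrow{x}X^0)\in\mathcal{C}^{[-1,0]}(\operatorname{proj}\Lambda)$, and let $\chi$ be a character of $G(X^{-1},X^0)$. If $x$ is $\chi$-semistable, then: (1) $\langle(-[X^{-1}],[X^0]),\chi\rangle=0$; (2) for any inflation $Y\rightarrowtail X$ in $\mathcal{C}^{[-1,0]}(\operatorname{proj}\Lambda)$, where $Y=(Y^{-1}\xrightarrow{y}Y^0)$, one has $\langle(-[Y^{-1}],[Y^0]),\chi\rangle\geq0$.
   Context: $\Lambda\cong\mathbb{C}Q/I$ is a finite-dimensional $\mathbb{C}$-algebra, with $Q$ a finite quiver with $n$ vertices and $I$ an admissible ideal; $P_1,\dots,P_n$ are the indecomposable projective modules. Fix $\theta^{-1},\theta^0\in\mathbb{Z}_{\geq0}^n$ and $X^{-1}=\bigoplus_{i=1}^nP_i^{\theta_i^{-1}}$, $X^0=\bigoplus_{i=1}^nP_i^{\theta_i^0}$. The group $G=G(X^{-1},X^0)=\operatorname{Aut}(X^{-1})^{op}\times\operatorname{Aut}(X^0)$ acts on the affine space $R=R(X^{-1},X^0)=\operatorname{Hom}_\Lambda(X^{-1},X^0)$ by $(g_{-1},g_0)\cdot x=g_0\,x\,g_{-1}$. The reductive part of $G$ is $\prod_{i=1}^n(GL_{\theta_i^{-1}}(\mathbb{C})\times GL_{\theta_i^0}(\mathbb{C}))$, and every character $\chi:G\to\mathbb{C}^*$ (morphism of algebraic groups) factors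 through it and is of the form $\chi=\chi_{(d^{-1},d^0)}$, $(d^{-1},d^0)\in\mathbb{Z}^{2n}$, with $\chi_{(d^{-1},d^0)}((g_{-1}^i,g_0^i)_i)=\prod_{i=1}^n\det(g_{-1}^i)^{d_i^{-1}}\det(g_0^i)^{d_i^0}$. A semi-invariant of weight $\chi$ is a regular function $f\in\mathbb{C}[R]$ with $f(g\cdot x)=\chi(g)f(x)$ for all $g\in G$, $x\in R$; $\mathbb{C}[R]^{G,\chi}$ is the set of these. $x\in R$ is $\chi$-semistable if there are $m\in\mathbb{Z}_{>0}$ and $f\in\mathbb{C}[R]^{G,\chi^m}$ with $f(x)\neq0$. For a finitely generated projective module $Q\cong\bigoplus_iP_i^{q_i}$, $[Q]=(q_i)_i\in\mathbb{Z}^n$, and for $\chi=\chi_{(d^{-1},d^0)}$, $\langle(-[Q^{-1}],[Q^0]),\chi\rangle=-\sum_i[Q^{-1}]_id_i^{-1}+\sum_i[Q^0]_id_i^0$. $\mathcal{C}^{[-1,0]}(\operatorname{proj}\Lambda)$ is the category of morphisms $Y^{-1}\to Y^0$ between finitely generated projective modules (with commutative squares as morphisms), exact with conflations the sequences $A\to B\to C$ such that $0\to A^i\to B^i\to C^i\to0$ is exact for $i=-1,0$; an inflation is the first map of a conflation. *)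

(* Defs.v *)
From HB Require Import structures.
From mathcomp Require Import all_boot all_order all_algebra all_field.
From mathcomp Require Import finmap.
From mathcomp Require Import reals complex.
From mathcomp Require Import monalg.
From mathcomp Require mpoly.

Set Implicit Arguments.
Unset Strict Implicit.
Unset Printing Implicit Defensive.

Import GRing.Theory.
Local Open Scope ring_scope.

Record quiver (n : nat) := Quiver {
  arrow : finType;
  src : arrow -> 'I_n;
  tgt : arrow -> 'I_n
}.
Arguments src {n q}.
Arguments tgt {n q}.

Section Paths.
Context {n : nat} (Q : quiver n).

Fixpoint composable (v : 'I_n) (s : seq (arrow Q)) : bool :=
  if s is a :: s' then (src a == v) && composable (tgt a) s' else true.

(* A path is a starting vertex and the arrows in the order of travel; the
   stationary path at v is (v, [::]). *)
Definition qpath := {p : 'I_n * seq (arrow Q) | composable p.1 p.2}.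

HB.instance Definition _ := SubChoice.on qpath.

Definition pstart (p : qpath) : 'I_n := (val p).1.
Definition parrows (p : qpath) : seq (arrow Q) := (val p).2.
Definition pend (p : qpath) : 'I_n := last (pstart p) (map tgt (parrows p)).
Definition plength (p : qpath) : nat := size (parrows p).

Definition stationary (v : 'I_n) : qpath :=
  exist (fun p : 'I_n * seq (arrow Q) => composable p.1 p.2) (v, [::]) isT.

(* Paths compose like functions: p after q, defined when q ends where p
   starts.  With left modules, P_i is then spanned by the paths starting at i. *)
Definition pcomp (p q : qpath) : option qpath :=
  if pend q == pstart p then
    (insub (pstart q, parrows q ++ parrows p) : option qpath)
  else None.

Lemma composable_cat v s t :
  composable v (s ++ t) = composable v s && composable (last v (map tgt s)) t.
Proof. by elim: s v => //= a s IHs v; rewrite IHs andbA. Qed.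

Lemma pcompE p q r : pcomp p q = Some r <->
  pend q = pstart p /\ val r = (pstart q, parrows q ++ parrows p).
Proof.
rewrite /pcomp; split.
  case: eqP => // e; case: insubP => // u _ vu [<-]; by split.
case=> -> vr; rewrite eqxx.
by rewrite -vr valK.
Qed.

Lemma pcompN p q : pcomp p q = None <-> pend q <> pstart p.
Proof.
rewrite /pcomp; case: eqP => // e; split=> //.
rewrite insubT //=; rewrite composable_cat; apply/andP; split; first exact: (valP q).
by rewrite -/(pend q) e (valP p).
Qed.

Lemma pstart_comp p q r : pcomp p q = Some r -> pstart r = pstart q.
Proof. by case/pcompE=> _; rewrite /pstart => ->. Qed.

Lemma pend_comp p q r : pcomp p q = Some r -> pend r = pend p.
Proof.
case/pcompE=> e v; rewrite /pend /pstart /parrows v /= map_cat last_cat.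
by rewrite -/(pend q) e.
Qed.

Lemma pcompA p q r :
  obind (pcomp p) (pcomp q r) = obind (pcomp^~ r) (pcomp p q).
Proof.
case Eqr: (pcomp q r) => [s|] /=; case Epq: (pcomp p q) => [t|] //=.
- have [e1 v1] := (pcompE _ _ _).1 Eqr; have [e2 v2] := (pcompE _ _ _).1 Epq.
  case E: (pcomp t r) => [u|].
    apply/pcompE; have [e3 v3] := (pcompE _ _ _).1 E.
    split; first by rewrite (pend_comp Eqr).
    by rewrite v3 /pstart /parrows v1 v2 /= catA.
  by move/pcompN: E; rewrite (pstart_comp Epq) e1.
- by apply/pcompN; rewrite (pend_comp Eqr); apply/pcompN.
- by apply/esym/pcompN; rewrite (pstart_comp Epq); apply/pcompN.
Qed.

Lemma pcomp1p v p : pcomp (stationary v) p = if pend p == v then Some p else None.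
Proof.
case: eqP => [e|ne]; last exact/pcompN.
by apply/pcompE; split=> //=; rewrite cats0 /pstart /parrows -surjective_pairing.
Qed.

Lemma pcompp1 v p : pcomp p (stationary v) = if v == pstart p then Some p else None.
Proof.
case: eqP => [e|ne]; last exact/pcompN.
by apply/pcompE; split=> //=; rewrite {1}/pstart /= e /pstart /parrows -surjective_pairing.
Qed.

End Paths.

(* Identities of a bilinear product are checked on a spanning family. *)
Section Bilinear.
Context (K : fieldType) (V : lmodType K) (I : Type) (B : I -> V) (mul : V -> V -> V).
Hypotheses (mulDl : left_distributive mul +%R) (mulDr : right_distributive mul +%R).
Hypotheses (mulZl : forall c f g, mul (c *: f) g = c *: mul f g)
           (mulZr : forall c f g, mul f (c *: g) = c *: mul f g).
Hypothesis ind : forall P : V -> Prop, P 0 -> (forall f g, P f -> P g -> P (f + g)) ->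
  (forall c p, P (c *: B p)) -> forall f, P f.

Let mul0r f : mul 0 f = 0. Proof. by rewrite -[0](scale0r 0) mulZl !scale0r. Qed.
Let mulr0 f : mul f 0 = 0. Proof. by rewrite -[0](scale0r 0) mulZr !scale0r. Qed.

Lemma bilinear_assoc :
  (forall p q r, mul (B p) (mul (B q) (B r)) = mul (mul (B p) (B q)) (B r)) ->
  associative mul.
Proof.
move=> BA f g h; elim/ind: f => [|f1 f2 IH1 IH2|c p].
- by rewrite !mul0r.
- by rewrite !mulDl IH1 IH2.
rewrite !mulZl; congr (_ *: _).
elim/ind: g => [|g1 g2 IH1 IH2|{}c q].
- by rewrite !(mul0r, mulr0).
- by rewrite !(mulDl, mulDr) IH1 IH2.
rewrite !(mulZl, mulZr); congr (_ *: _).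
elim/ind: h => [|h1 h2 IH1 IH2|{}c r].
- by rewrite !mulr0.
- by rewrite !mulDr IH1 IH2.
by rewrite !mulZr BA.
Qed.

Lemma bilinear_unitl e : (forall p, mul e (B p) = B p) -> left_id e mul.
Proof.
move=> Be f; elim/ind: f => [|f1 f2 IH1 IH2|c p]; first exact: mulr0.
- by rewrite mulDr IH1 IH2.
by rewrite mulZr Be.
Qed.

Lemma bilinear_unitr e : (forall p, mul (B p) e = B p) -> right_id e mul.
Proof.
move=> Be f; elim/ind: f => [|f1 f2 IH1 IH2|c p]; first exact: mul0r.
- by rewrite mulDl IH1 IH2.
by rewrite mulZl Be.
Qed.

End Bilinear.

Definition path_algebra (K : fieldType) (n : nat) (Q : quiver n) : Type :=
  {malg K[qpath Q]}.

Section PathAlgebra.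
Context (K : fieldType) (n : nat) (Q : quiver n).
Local Notation KQ := (path_algebra K Q).

HB.instance Definition _ := GRing.Lmodule.on KQ.

Implicit Types (f g h : KQ) (p q : qpath Q).

Definition pbasis p : KQ := << p >>.
Definition opath (o : option (qpath Q)) : KQ := if o is Some p then pbasis p else 0.

Definition pa_mul f g : KQ :=
  \sum_(p <- msupp f) \sum_(q <- msupp g) (f@_p * g@_q) *: opath (pcomp p q).

Definition pa_one : KQ := \sum_v pbasis (stationary Q v).

Lemma pa_mulw (d1 d2 : {fset qpath Q}) f g :
  (msupp f `<=` d1)%fset -> (msupp g `<=` d2)%fset ->
  pa_mul f g = \sum_(p <- d1) \sum_(q <- d2) (f@_p * g@_q) *: opath (pcomp p q).
Proof.
move=> le1 le2; rewrite /pa_mul (big_fset_incl _ le1) /=.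
  apply: eq_bigr => p _; apply: big_fset_incl => // q _ /mcoeff_outdom ->.
  by rewrite mulr0 scale0r.
move=> p _ /mcoeff_outdom ->; rewrite big1 // => q _.
by rewrite mul0r scale0r.
Qed.

Lemma pa_mulDl : left_distributive pa_mul +%R.
Proof.
move=> f g h.
have le1 : (msupp f `<=` msupp f `|` msupp g)%fset by exact: fsubsetUl.
have le2 : (msupp g `<=` msupp f `|` msupp g)%fset by exact: fsubsetUr.
rewrite (pa_mulw (msuppD_le f g) (fsubset_refl _)).
rewrite (pa_mulw le1 (fsubset_refl _)) (pa_mulw le2 (fsubset_refl _)).
rewrite -big_split /=; apply: eq_bigr => p _.
rewrite -big_split /=; apply: eq_bigr => q _.
by rewrite mcoeffD mulrDl scalerDl.
Qed.

Lemma pa_mulDr : right_distributive pa_mul +%R.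
Proof.
move=> h f g.
have le1 : (msupp f `<=` msupp f `|` msupp g)%fset by exact: fsubsetUl.
have le2 : (msupp g `<=` msupp f `|` msupp g)%fset by exact: fsubsetUr.
rewrite (pa_mulw (fsubset_refl _) (msuppD_le f g)).
rewrite (pa_mulw (fsubset_refl _) le1) (pa_mulw (fsubset_refl _) le2).
rewrite -big_split /=; apply: eq_bigr => p _.
rewrite -big_split /=; apply: eq_bigr => q _.
by rewrite mcoeffD mulrDr scalerDl.
Qed.

Lemma pa_mul0r f : pa_mul 0 f = 0.
Proof. by rewrite /pa_mul msupp0 big_seq_fset0. Qed.

Lemma pa_mulr0 f : pa_mul f 0 = 0.
Proof. by rewrite /pa_mul big1 // => p _; rewrite msupp0 big_seq_fset0. Qed.

Lemma pa_mulUU p q : pa_mul (pbasis p) (pbasis q) = opath (pcomp p q).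
Proof.
rewrite (pa_mulw msuppU_le msuppU_le) !big_seq_fset1 !mcoeffUU.
by rewrite mulr1 scale1r.
Qed.

Lemma pa_mulZl c f g : pa_mul (c *: f) g = c *: pa_mul f g.
Proof.
rewrite (pa_mulw (msuppZ_le c f) (fsubset_refl _)) /pa_mul scaler_sumr.
apply: eq_bigr => p _; rewrite scaler_sumr; apply: eq_bigr => q _.
by rewrite mcoeffZ scalerA mulrA.
Qed.

Lemma pa_mulZr c f g : pa_mul f (c *: g) = c *: pa_mul f g.
Proof.
rewrite (pa_mulw (fsubset_refl _) (msuppZ_le c g)) /pa_mul scaler_sumr.
apply: eq_bigr => p _; rewrite scaler_sumr; apply: eq_bigr => q _.
by rewrite mcoeffZ scalerA !mulrA (mulrC c).
Qed.

Lemma paE f : f = \sum_(p <- msupp f) f@_p *: pbasis p.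
Proof.
rewrite {1}[f]monalgE; apply: eq_bigr => p _; apply/malgP => q.
by rewrite mcoeffZ [in LHS]mcoeffU [in RHS]mcoeffU; case: (p == q); rewrite ?mulr1 ?mulr0.
Qed.

Lemma pa_ind (P : KQ -> Prop) : P 0 -> (forall f g, P f -> P g -> P (f + g)) ->
  (forall c p, P (c *: pbasis p)) -> forall f, P f.
Proof. by move=> P0 PD PZ f; rewrite [f]paE; elim/big_ind: _. Qed.

Lemma pa_mul_opathl o q : pa_mul (opath o) (pbasis q) = opath (obind (fun p => pcomp p q) o).
Proof. by case: o => [p|] /=; rewrite ?pa_mulUU ?pa_mul0r. Qed.

Lemma pa_mul_opathr o p : pa_mul (pbasis p) (opath o) = opath (obind (pcomp p) o).
Proof. by case: o => [q|] /=; rewrite ?pa_mulUU ?pa_mulr0. Qed.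

Lemma pa_mulA : associative pa_mul.
Proof.
apply: (bilinear_assoc pa_mulDl pa_mulDr pa_mulZl pa_mulZr pa_ind) => p q r.
(* Not by rewriting, which would compare products up to conversion. *)
have El := congr1 (pa_mul (pbasis p)) (pa_mulUU q r).
have Er := congr1 (pa_mul^~ (pbasis r)) (pa_mulUU p q).
apply: (etrans El); apply: (etrans (pa_mul_opathr _ _)).
apply: esym; apply: (etrans Er); apply: (etrans (pa_mul_opathl _ _)).
exact: (congr1 opath (esym (pcompA p q r))).
Qed.

Lemma sum_opath w p :
  \sum_(v : 'I_n) opath (if v == w then Some p else None) = pbasis p.
Proof.
rewrite (eq_bigr (fun v => if v == w then pbasis p else 0)); last by move=> v _; case: ifP.
by rewrite -big_mkcond big_pred1_eq.
Qed.

Lemma pa_mul1r : left_id pa_one pa_mul.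
Proof.
apply: (bilinear_unitl pa_mulDr pa_mulZr pa_ind) => p.
rewrite /pa_one (big_morph (pa_mul^~ _) (fun _ _ => pa_mulDl _ _ _) (pa_mul0r _)).
apply: etrans (sum_opath (pend p) p); apply: eq_bigr => v _.
apply: (etrans (pa_mulUU _ _)); apply: (etrans (congr1 opath (pcomp1p v p))).
by rewrite eq_sym.
Qed.

Lemma pa_mulr1 : right_id pa_one pa_mul.
Proof.
apply: (bilinear_unitr pa_mulDl pa_mulZl pa_ind) => p.
rewrite /pa_one (big_morph (pa_mul _) (fun _ _ => pa_mulDr _ _ _) (pa_mulr0 _)).
apply: etrans (sum_opath (pstart p) p); apply: eq_bigr => v _.
exact: (etrans (pa_mulUU _ _) (congr1 opath (pcompp1 v p))).
Qed.

HB.instance Definition _ := GRing.Zmodule_isPzRing.Build KQ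
  pa_mulA pa_mul1r pa_mulr1 pa_mulDl pa_mulDr.

(* The m-th power of the arrow ideal: the span of the paths of length >= m. *)
Definition arrow_ideal_pow (m : nat) f : Prop :=
  {in msupp f, forall p, (m <= plength p)%N}.

Definition two_sided_ideal (I : KQ -> Prop) : Prop :=
  [/\ I 0, forall f g, I f -> I g -> I (f + g) & forall f g h, I f -> I (g * f * h)].

Definition admissible (I : KQ -> Prop) : Prop :=
  [/\ two_sided_ideal I,
      exists2 m : nat, (2 <= m)%N & forall f, arrow_ideal_pow m f -> I f
    & forall f, I f -> arrow_ideal_pow 2 f].

End PathAlgebra.

(* An isomorphism of K-algebras KQ/I ~ L with I admissible, given as a
   surjective algebra morphism KQ -> L with kernel I. *)
Record presentation (K : fieldType) (n : nat) (Q : quiver n) (L : falgType K) :=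
  Presentation {
    pres_ideal : path_algebra K Q -> Prop;
    pres_admissible : admissible pres_ideal;
    pres_map :> {linear path_algebra K Q -> L};
    pres_morphism : monoid_morphism pres_map;
    pres_surjective : forall a : L, exists f, pres_map f = a;
    pres_kernel : forall f, pres_map f = 0 <-> pres_ideal f
  }.

Section LeftIdeal.
Context (K : fieldType) (L : falgType K) (e : L).

(* The left ideal L e, as a module over L (L^o is L acting on itself). *)
Definition left_ideal_pred : {pred L^o} := fun v => (v : L) \in limg (amulr e).

Lemma left_idealP (v : L) : reflect (exists b, v = b * e) (v \in limg (amulr e)).
Proof.
apply: (iffP memv_imgP) => [[b _ ->]|[b ->]]; exists b; rewrite ?lfunE //.
exact: memvf.
Qed.

Fact left_ideal_submod : submod_closed left_ideal_pred.
Proof.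
split=> [|a _ _ /left_idealP [b ->] /left_idealP [c ->]]; first exact: mem0v.
by apply/left_idealP; exists (a * b + c); rewrite mulrDl -mulrA.
Qed.

HB.instance Definition _ :=
  GRing.isSubmodClosed.Build L L^o left_ideal_pred left_ideal_submod.

Record left_ideal := LeftIdeal {
  left_ideal_val : L^o;
  left_ideal_valP : left_ideal_val \in left_ideal_pred
}.

HB.instance Definition _ := [isSub for left_ideal_val].
HB.instance Definition _ := [Choice of left_ideal by <:].
HB.instance Definition _ := [SubChoice_isSubLmodule of left_ideal by <:].

End LeftIdeal.

Section DirectSum.
Context (L : pzRingType) (I : finType) (M : I -> lmodType L).

Definition dirsum : Type := {dffun forall i, M i}.

HB.instance Definition _ := Choice.on dirsum.

Implicit Types u v w : dirsum.

Definition dirsum_fun v : forall i, M i := fun i => (v : {dffun forall i, M i}) i.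
Coercion dirsum_fun : dirsum >-> Funclass.

Definition dirsum_zero : dirsum := [ffun i => 0 : M i].
Definition dirsum_opp v : dirsum := [ffun i => - v i].
Definition dirsum_add u v : dirsum := [ffun i => u i + v i].
Definition dirsum_scale (a : L) v : dirsum := [ffun i => a *: v i].

Lemma dirsumP u v : (forall i, u i = v i) <-> u = v.
Proof. by split=> [uv|->//]; apply/ffunP. Qed.

Lemma dirsum_zeroE i : dirsum_zero i = 0. Proof. exact: ffunE. Qed.
Lemma dirsum_oppE v i : dirsum_opp v i = - v i. Proof. exact: ffunE. Qed.
Lemma dirsum_addE u v i : dirsum_add u v i = u i + v i. Proof. exact: ffunE. Qed.
Lemma dirsum_scaleE a v i : dirsum_scale a v i = a *: v i. Proof. exact: ffunE. Qed.
Let E := (dirsum_zeroE, dirsum_oppE, dirsum_addE, dirsum_scaleE).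

Local Ltac pointwise := apply/dirsumP=> i; rewrite !E.

Fact dirsum_addA : associative dirsum_add.
Proof. by move=> u v w; pointwise; rewrite addrA. Qed.
Fact dirsum_addC : commutative dirsum_add.
Proof. by move=> u v; pointwise; rewrite addrC. Qed.
Fact dirsum_add0 : left_id dirsum_zero dirsum_add.
Proof. by move=> v; pointwise; rewrite add0r. Qed.
Fact dirsum_addN : left_inverse dirsum_zero dirsum_opp dirsum_add.
Proof. by move=> v; pointwise; rewrite addNr. Qed.

HB.instance Definition _ :=
  GRing.isZmodule.Build dirsum dirsum_addA dirsum_addC dirsum_add0 dirsum_addN.

Fact dirsum_scaleA a b v : dirsum_scale a (dirsum_scale b v) = dirsum_scale (a * b) v.
Proof. by pointwise; rewrite scalerA. Qed.
Fact dirsum_scale1 : left_id 1 dirsum_scale.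
Proof. by move=> v; pointwise; rewrite scale1r. Qed.
Fact dirsum_scaleDr : right_distributive dirsum_scale +%R.
Proof. by move=> a u v; pointwise; rewrite scalerDr. Qed.
Fact dirsum_scaleDl v : {morph dirsum_scale^~ v : a b / a + b}.
Proof. by move=> a b; pointwise; rewrite scalerDl. Qed.

HB.instance Definition _ := GRing.Zmodule_isLmodule.Build L dirsum
  dirsum_scaleA dirsum_scale1 dirsum_scaleDr dirsum_scaleDl.

Lemma dirsumD u v i : (u + v) i = u i + v i. Proof. exact: dirsum_addE. Qed.
Lemma dirsumZ a v i : (a *: v) i = a *: v i. Proof. exact: dirsum_scaleE. Qed.

End DirectSum.

(* Finitely generated projective: a direct summand of some L^N. *)
Definition fg_projective (L : pzRingType) (M : lmodType L) : Prop :=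
  exists (N : nat) (s : {linear M -> 'rV[L]_N}) (r : {linear 'rV[L]_N -> M}), cancel s r.

Section Projectives.
Context (K : fieldType) (n : nat) (Q : quiver n) (L : falgType K).
Context (pi : presentation Q L).

Definition vertex_idem (i : 'I_n) : L := pi (pbasis K (stationary Q i)).

(* P_i = L e_i *)
Definition indec_proj (i : 'I_n) : lmodType L := left_ideal (vertex_idem i).

(* The direct sum of the P_i^(theta i); the element v has components
   v i r : P_i, for i : 'I_n and r : 'I_(theta i). *)
Definition proj_sum (theta : 'I_n -> nat) : lmodType L :=
  dirsum (fun i => {ffun 'I_(theta i) -> indec_proj i} : lmodType L).

Lemma vertex_idemM i : vertex_idem i * vertex_idem i = vertex_idem i.
Proof.
rewrite /vertex_idem -(pres_morphism pi).2; congr (pi _).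
apply: (etrans (pa_mulUU _ _ _)).
by apply: (etrans (congr1 _ (pcomp1p _ _))); rewrite /= /pend /= eqxx.
Qed.

Section ProjSumProjective.
Context (theta : 'I_n -> nat).
Local Notation I := {i : 'I_n & 'I_(theta i)}.

Lemma proj_sumE a (u v : proj_sum theta) i r : (a *: u + v) i r = a *: u i r + v i r.
Proof.
have -> : (a *: u + v) i = a *: u i + v i.
  exact: (etrans (dirsumD _ _ _) (congr1 (+%R^~ _) (dirsumZ _ _ _))).
by rewrite !ffunE.
Qed.

Definition proj_sum_coords (v : proj_sum theta) : 'rV[L]_#|{: I}| :=
  \row_k (left_ideal_val (v (tag (enum_val k)) (tagged (enum_val k))) : L).

Fact proj_sum_coords_linear : linear proj_sum_coords.
Proof.
move=> a u v; apply/rowP=> k; rewrite !mxE.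
by rewrite proj_sumE.
Qed.

HB.instance Definition _ :=
  GRing.isLinear.Build L (proj_sum theta) 'rV[L]_#|{: I}| _ proj_sum_coords
    proj_sum_coords_linear.

Fact mul_vertex_in (i : 'I_n) (a : L) :
  (a * vertex_idem i : L^o) \in left_ideal_pred (vertex_idem i).
Proof. by apply/left_idealP; exists a. Qed.

Definition proj_sum_proj (w : 'rV[L]_#|{: I}|) : proj_sum theta :=
  [ffun i => [ffun r => LeftIdeal
     (mul_vertex_in i (w ord0 (enum_rank (Tagged (fun i => 'I_(theta i)) r))))]].

Fact proj_sum_proj_linear : linear proj_sum_proj.
Proof.
move=> a u v; apply/dirsumP=> i; apply/ffunP=> r.
rewrite proj_sumE /proj_sum_proj /dirsum_fun !ffunE.
by apply: val_inj; rewrite /= !mxE mulrDl -mulrA.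
Qed.

HB.instance Definition _ :=
  GRing.isLinear.Build L 'rV[L]_#|{: I}| (proj_sum theta) _ proj_sum_proj
    proj_sum_proj_linear.

Lemma proj_sum_projective : fg_projective (proj_sum theta).
Proof.
exists #|{: I}|, proj_sum_coords, proj_sum_proj => v.
apply/dirsumP=> i; apply/ffunP=> r; rewrite {1}/dirsum_fun !ffunE.
apply: val_inj; rewrite /= mxE enum_rankK /=.
by have /left_idealP [b ->] := left_ideal_valP (v i r); rewrite -mulrA vertex_idemM.
Qed.

End ProjSumProjective.

(* [M] = q, i.e. M is isomorphic to the direct sum of the P_i^(q i). *)
Definition proj_class (M : lmodType L) (q : 'I_n -> nat) : Prop :=
  exists f : {linear M -> proj_sum q}, bijective f.

End Projectives.

Record two_term (L : pzRingType) := TwoTerm {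
  term_m1 : lmodType L;
  term_0 : lmodType L;
  term_m1_proj : fg_projective term_m1;
  term_0_proj : fg_projective term_0;
  tdiff : {linear term_m1 -> term_0}
}.

Section TwoTerm.
Context (L : pzRingType).

Record two_term_hom (X Y : two_term L) := TwoTermHom {
  hom_m1 : {linear term_m1 X -> term_m1 Y};
  hom_0 : {linear term_0 X -> term_0 Y};
  hom_comm : forall v, hom_0 (tdiff X v) = tdiff Y (hom_m1 v)
}.

Definition short_exact (A B C : lmodType L) (f : {linear A -> B}) (g : {linear B -> C}) :=
  [/\ injective f, forall b, g b = 0 <-> (exists a, f a = b)
    & forall c, exists b, g b = c].

Definition conflation (A B C : two_term L) (f : two_term_hom A B) (g : two_term_hom B C) :=
  short_exact (hom_m1 f) (hom_m1 g) /\ short_exact (hom_0 f) (hom_0 g).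

Definition inflation (A B : two_term L) (f : two_term_hom A B) : Prop :=
  exists (C : two_term L) (g : two_term_hom B C), conflation f g.

End TwoTerm.

Definition two_term_of (K : fieldType) (n : nat) (Q : quiver n) (L : falgType K)
    (pi : presentation Q L) (thm1 th0 : 'I_n -> nat)
    (x : {linear proj_sum pi thm1 -> proj_sum pi th0}) : two_term L :=
  TwoTerm (proj_sum_projective pi thm1) (proj_sum_projective pi th0) x.

Record aut (L : pzRingType) (M : lmodType L) := Aut {
  aut_fun :> {linear M -> M};
  aut_inv : {linear M -> M};
  aut_funK : cancel aut_fun aut_inv;
  aut_invK : cancel aut_inv aut_fun
}.

Definition aut_comp (L : pzRingType) (M : lmodType L) (g h : aut M) : aut M :=
  @Aut L M (g \o h) (aut_inv h \o aut_inv g)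
    (can_comp (aut_funK g) (aut_funK h)) (can_comp (aut_invK h) (aut_invK g)).

Section Regular.
Context (K : fieldType).

(* Linear functionals on the K-vector space Hom_L(M, N), on which c : K acts
   through the central scalar c%:A of L. *)
Definition hom_functional (L : falgType K) (M N : lmodType L)
    (l : {linear M -> N} -> K) : Prop :=
  forall (c : K) (f g h : {linear M -> N}),
    (forall v, h v = c%:A *: f v + g v) -> l h = c * l f + l g.

(* The functions that are polynomials in finitely many of the given
   coordinate functions. *)
Definition polynomial_in (T : Type) (coord : (T -> K) -> Prop) (f : T -> K) : Prop :=
  exists (k : nat) (l : 'I_k -> T -> K) (p : mpoly.mpoly k K),
    (forall i, coord (l i)) /\ (forall t, f t = mpoly.meval (fun i => l i t) p).

End Regular.

Section Action.
Context (K : fieldType) (L : falgType K) (M N : lmodType L).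
Local Notation G := (aut M * aut N)%type.
Local Notation R := {linear M -> N}.

(* G = Aut(M)^op x Aut(N): the first factor multiplies in reverse. *)
Definition grp_mul (g h : G) : G := (aut_comp h.1 g.1, aut_comp g.2 h.2).

Definition grp_act (g : G) (x : R) : R := (g.2 : {linear N -> N}) \o (x \o (g.1 : {linear M -> M})).

Definition regular_on_hom (f : R -> K) : Prop := polynomial_in (@hom_functional K L M N) f.

(* The coordinate ring of G is generated by the coordinates of g and of g^-1,
   G being closed in a product of two general linear groups. *)
Variant grp_coord : (G -> K) -> Prop :=
| Coord_m1 l of hom_functional l : grp_coord (fun g => l (aut_fun g.1))
| Coord_m1V l of hom_functional l : grp_coord (fun g => l (aut_inv g.1))
| Coord_0 l of hom_functional l : grp_coord (fun g => l (aut_fun g.2))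
| Coord_0V l of hom_functional l : grp_coord (fun g => l (aut_inv g.2)).

(* Morphisms of algebraic groups G -> K^*. *)
Definition character (chi : G -> K) : Prop :=
  [/\ polynomial_in grp_coord chi, forall g, chi g != 0
    & forall g h, chi (grp_mul g h) = chi g * chi h].

Definition semi_invariant (chi : G -> K) (f : R -> K) : Prop :=
  regular_on_hom f /\ forall g x, f (grp_act g x) = chi g * f x.

Definition semistable (chi : G -> K) (x : R) : Prop :=
  exists (m : nat) (f : R -> K),
    [/\ (0 < m)%N, semi_invariant (fun g => chi g ^+ m) f & f x != 0].

End Action.

Section Weights.
Context (K : fieldType) (n : nat) (Q : quiver n) (L : falgType K) (pi : presentation Q L).

(* g is the element of the reductive part of Aut(proj_sum theta) with
   components h i in GL_(theta i)(K). *)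
Definition reductive_elt (theta : 'I_n -> nat) (h : forall i, 'M[K]_(theta i))
    (g : aut (proj_sum pi theta)) : Prop :=
  (forall i, h i \in unitmx) /\
  (forall v i r, aut_fun g v i r = \sum_s (h i r s)%:A *: v i s).

(* chi = chi_(dm1, d0).  A character of G is determined by its restriction to
   the reductive part, on which chi_(dm1, d0) is a product of powers of
   determinants. *)
Definition has_weight (thm1 th0 : 'I_n -> nat)
    (chi : aut (proj_sum pi thm1) * aut (proj_sum pi th0) -> K)
    (dm1 d0 : 'I_n -> int) : Prop :=
  forall (km1 : forall i, 'M[K]_(thm1 i)) (k0 : forall i, 'M[K]_(th0 i)) g,
    reductive_elt km1 g.1 -> reductive_elt k0 g.2 ->
    chi g = \prod_i (\det (km1 i) ^ dm1 i * \det (k0 i) ^ d0 i).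

End Weights.

(* <(-[Q^-1], [Q^0]), chi> with [Q^-1] = qm1, [Q^0] = q0, chi = chi_(dm1, d0) *)
Definition weight_pairing (n : nat) (qm1 q0 : 'I_n -> nat) (dm1 d0 : 'I_n -> int) : int :=
  - (\sum_i (qm1 i)%:Z * dm1 i) + \sum_i (q0 i)%:Z * d0 i.

(* Main.v *)
Require Import Defs.
From HB Require Import structures.
From mathcomp Require Import all_boot all_order all_algebra all_field.
From mathcomp Require Import reals complex.
From mathcomp Require Import finmap monalg ring.
From mathcomp Require mpoly.

(** A split subobject Y of X, given by idempotents e1 on X^-1 and e0 on X^0
    with e0 x e1 = x e1, defines a one-parameter subgroup of G: scale e0 by t
    and e1 by t^-1, and leave the complements alone.  In block form, the
    components Y -> Y and Z -> Z of x are fixed by it, the component Z -> Y is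
    multiplied by t, and the component Y -> Z vanishes because Y is a
    subobject.  Hence t . x = x + (t - 1) y depends polynomially on t, and so
    does f (t . x) for every regular function f.  If f is a semi-invariant of
    weight chi^m with f x <> 0, then f (t . x) = chi(t)^m f x is a constant
    times t^(k m), where k is the pairing of the class of Y with chi; being
    polynomial in t forces 0 <= k.  For Y = X the point x is fixed by the
    subgroup, so running it backwards gives also k <= 0.

    It remains to see that chi(t) = t^k ([character_dilation]), although chi is
    only known explicitly on the reductive part of G, in which the idempotents
    e need not lie.  The coefficient of a path algebra element at a stationary
    path induces an algebra morphism from L to the ground field
    ([vertex_coef]).  These morphisms attach to a map of projectives, for each
    vertex, its matrix modulo the radical ([residue]), functorially.  The
    residue of e lifts to an idempotent e' with scalar matrix entries, and
    u = e e' + (1 - e)(1 - e') satisfies e u = u e'; it is congruent to 1 modulo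
    the radical, which is nilpotent, so u is invertible
    ([idempotent_conj_lift]).  Therefore 1 + (t - 1) e is conjugate to the
    reductive element 1 + (t - 1) e', and chi takes the same value on both.
    Finally e = s r with r s = 1 on the sum of the P_i^(q i), so the i-th
    residue of e factors through K^(q i) in the same way and
    det (1 + (t - 1) S R) = det (1 + (t - 1) R S) = t^(q i).

    An inflation splits in each degree because the terms of its cokernel are
    projective ([short_exact_retract]), which provides e1 and e0. *)

Set Implicit Arguments.
Unset Strict Implicit.
Unset Printing Implicit Defensive.

Import GRing.Theory Num.Theory.
Local Open Scope ring_scope.
Local Open Scope complex_scope.

(** * Path coefficients and the radical filtration *)

(* The bare name otherwise denotes the composition of partial functions. *)
Local Notation pcomp := Defs.pcomp.

Section PathCoefficients.
Context (K : fieldType) (n : nat) (Q : quiver n).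
Local Notation KQ := (path_algebra K Q).
Implicit Types (f g : KQ) (p q r : qpath Q).

Lemma mcoeff_pbasis p q : (pbasis K p)@_q = (p == q)%:R.
Proof. by rewrite /pbasis mcoeffU. Qed.

Lemma sum_mcoeff_pred1 f p : \sum_(q <- msupp f) f@_q * (q == p)%:R = f@_p.
Proof.
rewrite [in RHS](paE f) raddf_sum /=; apply: eq_bigr => q _.
by rewrite mcoeffZ mcoeff_pbasis.
Qed.

Lemma mcoeff_path_mul f g p :
  (f * g)@_p =
  \sum_(q <- msupp f) \sum_(r <- msupp g) f@_q * g@_r * (pcomp q r == Some p)%:R.
Proof.
have -> : f * g = pa_mul f g by [].
rewrite /pa_mul raddf_sum /=; apply: eq_bigr => q _.
rewrite raddf_sum /=; apply: eq_bigr => r _.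
rewrite mcoeffZ; congr (_ * _).
case: (pcomp q r) => [s|] /=; last by rewrite mcoeff0.
by rewrite mcoeff_pbasis.
Qed.

Lemma plength_comp p q r : pcomp p q = Some r -> plength r = (plength p + plength q)%N.
Proof. by case/pcompE=> _ E; rewrite /plength {1}/parrows E size_cat addnC. Qed.

Lemma plength0 p : plength p = 0%N -> p = stationary Q (pstart p).
Proof.
move=> p0; apply: val_inj; case: p p0 => -[v s] sP.
by rewrite /plength /parrows /pstart /= => /size0nil ->.
Qed.

Lemma pcomp_eq_stationary p q v :
  (pcomp p q == Some (stationary Q v)) = (p == stationary Q v) && (q == stationary Q v).
Proof.
apply/eqP/andP => [E|[/eqP-> /eqP->]]; last by rewrite pcomp1p /pend /= eqxx.
have := plength_comp E; move/esym/eqP; rewrite addn_eq0 => /andP[/eqP p0 /eqP q0].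
have := pend_comp E; have := pstart_comp E.
rewrite (plength0 p0) (plength0 q0) /pend /pstart /= => <- <-.
by rewrite !eqxx.
Qed.

(** A product of paths is stationary only when both factors are, so this
    coefficient is an algebra morphism. *)
Lemma mcoeff_stationaryM f g v :
  (f * g)@_(stationary Q v) = f@_(stationary Q v) * g@_(stationary Q v).
Proof.
rewrite mcoeff_path_mul -[in RHS]sum_mcoeff_pred1 -[in X in _ = _ * X]sum_mcoeff_pred1.
rewrite big_distrlr /=; apply: eq_bigr => q _; apply: eq_bigr => r _.
by rewrite pcomp_eq_stationary -mulnb natrM mulrACA.
Qed.

Lemma arrow_ideal_powM m k f g :
  arrow_ideal_pow m f -> arrow_ideal_pow k g -> arrow_ideal_pow (m + k) (f * g).
Proof.
move=> fm gk p; rewrite -mcoeff_neq0; apply: contraNT; rewrite -ltnNge => ltp.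
rewrite mcoeff_path_mul big_seq big1 // => q qf; rewrite big_seq big1 // => r rg.
case: eqP => [/plength_comp E|_]; last by rewrite mulr0.
by move: ltp; rewrite E ltnNge leq_add ?fm ?gk.
Qed.

Lemma arrow_ideal_powD m f g :
  arrow_ideal_pow m f -> arrow_ideal_pow m g -> arrow_ideal_pow m (f + g).
Proof.
move=> fm gm p /(fsubsetP (msuppD_le f g)); rewrite inE.
by case/orP => [/fm|/gm].
Qed.

End PathCoefficients.

Section Radical.
Context (K : fieldType) (n : nat) (Q : quiver n) (L : falgType K).
Context (pi : presentation Q L).

Fact pres_surjectiveb (a : L) : exists f, pi f == a.
Proof. by have [f <-] := pres_surjective pi a; exists f. Qed.

(** The coefficient of the stationary path at [v] in any preimage of [a]: the
    choice is immaterial since that coefficient vanishes on an admissible ideal. *)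
Definition vertex_coef (v : 'I_n) (a : L) : K :=
  (xchoose (pres_surjectiveb a))@_(stationary Q v).

Lemma vertex_coef_pres v f : vertex_coef v (pi f) = f@_(stationary Q v).
Proof.
rewrite /vertex_coef; set g := xchoose _.
have /eqP gf : pi g == pi f := xchooseP (pres_surjectiveb (pi f)).
have [_ _ /(_ (g - f))] := pres_admissible pi.
rewrite -(pres_kernel pi) raddfB /= gf subrr => /(_ erefl) /(_ (stationary Q v)) ker.
apply/eqP; rewrite -subr_eq0 -mcoeffB; apply: contraTT isT.
by rewrite mcoeff_neq0 => /ker.
Qed.

Fact vertex_coef_linear v : linear_for *%R (vertex_coef v).
Proof.
move=> c a b; have [f <-] := pres_surjective pi a; have [g <-] := pres_surjective pi b.
by rewrite -linearP !vertex_coef_pres mcoeffD mcoeffZ.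
Qed.

HB.instance Definition _ v := GRing.isLinear.Build K L K *%R (vertex_coef v)
  (vertex_coef_linear v).

Lemma vertex_coefM v a b : vertex_coef v (a * b) = vertex_coef v a * vertex_coef v b.
Proof.
have [f <-] := pres_surjective pi a; have [g <-] := pres_surjective pi b.
by rewrite -(pres_morphism pi).2 !vertex_coef_pres mcoeff_stationaryM.
Qed.

Lemma vertex_coef_idem v w : vertex_coef v (vertex_idem pi w) = (w == v)%:R.
Proof.
rewrite /vertex_idem vertex_coef_pres mcoeff_pbasis.
by congr (nat_of_bool _)%:R; apply/eqP/eqP => [[]|->].
Qed.

(** The [m]-th power of the Jacobson radical, encoded as the image of the paths
    of length at least [m]. *)
Definition radical_pow (m : nat) (a : L) : Prop := exists2 f, arrow_ideal_pow m f & pi f = a.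

Lemma radical_pow0 a : radical_pow 0 a.
Proof. by have [f <-] := pres_surjective pi a; exists f. Qed.

Lemma radical_pow_0 m : radical_pow m 0.
Proof. by exists 0; rewrite ?raddf0 // => p; rewrite msupp0. Qed.

Lemma radical_powD m a b : radical_pow m a -> radical_pow m b -> radical_pow m (a + b).
Proof.
move=> [f fm <-] [g gm <-]; exists (f + g); last exact: raddfD.
exact: arrow_ideal_powD.
Qed.

Lemma radical_powM m k a b :
  radical_pow m a -> radical_pow k b -> radical_pow (m + k) (a * b).
Proof.
move=> [f fm <-] [g gk <-]; exists (f * g); last exact: (pres_morphism pi).2.
exact: arrow_ideal_powM.
Qed.

(** An element lies in the radical as soon as its vertex coefficients vanish,
    since the only paths of length 0 are the stationary ones. *)
Lemma radical_pow1 a : (forall v, vertex_coef v a = 0) -> radical_pow 1 a.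
Proof.
have [f <-] := pres_surjective pi a => f0; exists f => // p.
case: posnP => // /plength0 ->; rewrite -mcoeff_neq0.
by rewrite -vertex_coef_pres f0 eqxx.
Qed.

Lemma radical_nilpotent : exists m, forall a, radical_pow m a -> a = 0.
Proof.
have [_ [m _ mI] _] := pres_admissible pi; exists m => _ [f fm <-].
exact/(pres_kernel pi)/mI.
Qed.

End Radical.

(** * Linear maps with unipotent behaviour *)

Lemma linear_packed (A : pzRingType) (M N : lmodType A) (f : M -> N) :
  linear f -> exists g : {linear M -> N}, g =1 f.
Proof.
move=> f_lin; pose fL := GRing.isLinear.Build A M N *:%R f f_lin.
by exists (HB.pack f fL : {linear M -> N}).
Qed.

Lemma linear_inverse (A : pzRingType) (M N : lmodType A) (f : {linear M -> N}) g :
  cancel f g -> cancel g f -> exists h : {linear N -> M}, h =1 g.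
Proof. by move=> fK gK; apply: linear_packed; apply: can2_linear fK gK. Qed.

(** The inverse of [id - w] is the finite geometric series in [w]. *)
Lemma unipotent_bij (A : pzRingType) (M : lmodType A) (u : {linear M -> M}) m :
  (forall v, iter m (fun v => v - u v) v = 0) ->
  exists2 u' : {linear M -> M}, cancel u u' & cancel u' u.
Proof.
pose w v := v - u v; move=> w_nil.
pose g v := \sum_(k < m) iter k w v.
have gK : cancel g u.
  move=> v; have -> : u (g v) = g v - w (g v) by rewrite /w subKr.
  have w_sum : w (g v) = \sum_(k < m) iter k.+1 w v.
    rewrite /w /g raddf_sum -sumrB; exact: eq_bigr.
  rewrite w_sum -sumrB -(big_mkord xpredT (fun k => iter k w v - iter k.+1 w v)).
  rewrite -[LHS]opprK -sumrN (eq_bigr (fun k => iter k.+1 w v - iter k w v)).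
    by rewrite telescope_sumr // w_nil sub0r opprK.
  by move=> k _; rewrite opprB.
have u_inj : injective u.
  move=> a b uab; have w_fix k : iter k w (a - b) = a - b.
    by elim: k => //= k ->; rewrite /w linearB uab subrr subr0.
  by apply/eqP; rewrite -subr_eq0 -(w_fix m) w_nil.
have uK : cancel u g by move=> v; apply: u_inj; rewrite gK.
have [u' u'E] := linear_inverse uK gK.
by exists u' => v; rewrite !u'E.
Qed.

(** * Maps between sums of indecomposable projectives, modulo the radical *)

Section ProjectiveSums.
Context (K : fieldType) (n : nat) (Q : quiver n) (L : falgType K).
Context (pi : presentation Q L).
Local Notation P := (proj_sum pi).
Local Notation e_ := (vertex_idem pi).
Implicit Types (theta eta : 'I_n -> nat).

Definition proj_coord theta i (r : 'I_(theta i)) (v : P theta) : L^o :=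
  left_ideal_val (v i r).

Fact proj_coord_linear theta i (r : 'I_(theta i)) : linear (@proj_coord theta i r).
Proof. by move=> a u v; rewrite /proj_coord proj_sumE. Qed.

HB.instance Definition _ theta i (r : 'I_(theta i)) :=
  GRing.isLinear.Build L (P theta) L^o *:%R (@proj_coord theta i r)
    (@proj_coord_linear theta i r).

Lemma proj_coordP theta (u v : P theta) :
  (forall i r, @proj_coord theta i r u = @proj_coord theta i r v) -> u = v.
Proof.
move=> uv; apply/dirsumP => i; apply/ffunP => r; apply: val_inj; exact: uv.
Qed.

Lemma proj_coordZ theta i (r : 'I_(theta i)) (a : L) v :
  proj_coord r (a *: v) = a * proj_coord r v.
Proof. by rewrite linearZ. Qed.

Lemma proj_coord_idem theta i (r : 'I_(theta i)) (v : P theta) :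
  (proj_coord r v : L) * e_ i = proj_coord r v.
Proof.
have /left_idealP [b E] := left_ideal_valP (v i r).
by rewrite /proj_coord E -mulrA vertex_idemM.
Qed.

(** Multiplication by [e_ i] on the right makes the other vertex coefficients
    vanish; this is why residues are block diagonal over the vertices. *)
Lemma vertex_coef_proj_coord theta i j (r : 'I_(theta i)) (v : P theta) :
  i != j -> vertex_coef pi j (proj_coord r v) = 0.
Proof.
move=> /negPf ij; rewrite -proj_coord_idem vertex_coefM vertex_coef_idem.
by rewrite ij mulr0.
Qed.

(** The generator [e_ i] of the [s]-th copy of [P_i].  Comparing tagged indices
    spares a dependent case analysis on the equality of the two vertices. *)
Definition proj_gen theta i (s : 'I_(theta i)) : P theta :=
  [ffun j => [ffun r => LeftIdeal (mul_vertex_in pi j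
     (Tagged (fun i => 'I_(theta i)) s == Tagged (fun i => 'I_(theta i)) r)%:R)]].

Lemma proj_coord_gen theta i j (s : 'I_(theta i)) (r : 'I_(theta j)) :
  proj_coord r (proj_gen s) =
  (Tagged (fun i => 'I_(theta i)) s == Tagged (fun i => 'I_(theta i)) r)%:R * e_ j.
Proof. by rewrite /proj_coord /proj_gen /dirsum_fun !ffunE. Qed.

Lemma proj_gen_idem theta i (s : 'I_(theta i)) : e_ i *: proj_gen s = proj_gen s.
Proof.
apply: proj_coordP => j r; rewrite proj_coordZ !proj_coord_gen.
case: eqP => [/(congr1 tag) /= <-|_]; last by rewrite mul0r mulr0.
by rewrite mul1r vertex_idemM.
Qed.

Lemma proj_sum_gen theta (v : P theta) :
  v = \sum_i \sum_(s < theta i) (proj_coord s v : L) *: proj_gen s.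
Proof.
apply: proj_coordP => j r; rewrite raddf_sum (bigD1 j) //= raddf_sum (bigD1 r) //=.
rewrite proj_coordZ proj_coord_gen eqxx mul1r proj_coord_idem.
rewrite big1 => [|s /negPf sr]; last first.
  by rewrite proj_coordZ proj_coord_gen eq_Tagged /= sr mul0r mulr0.
rewrite addr0 big1 ?addr0 // => i /negPf ij; rewrite raddf_sum big1 // => s _.
rewrite /= proj_coordZ proj_coord_gen; case: eqP => [/(congr1 tag) /= E|_].
  by rewrite E eqxx in ij.
by rewrite mul0r mulr0.
Qed.

Lemma proj_coord_linearE theta eta (phi : {linear P theta -> P eta}) v j (r : 'I_(eta j)) :
  proj_coord r (phi v) =
  \sum_i \sum_(s < theta i) (proj_coord s v : L) * proj_coord r (phi (proj_gen s)).
Proof.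
rewrite {1}(proj_sum_gen v) !raddf_sum; apply: eq_bigr => i _.
rewrite !raddf_sum; apply: eq_bigr => s _.
by rewrite /= linearZ proj_coordZ.
Qed.

(** The component at vertex [i] of the class of [v] in the quotient of the
    projective by its radical. *)
Definition residue_vec theta i (v : P theta) : 'cV[K]_(theta i) :=
  \col_r vertex_coef pi i (proj_coord r v).

(** The matrix induced on the quotients by the radical.  Columns are indexed by
    the source, so that composition becomes the product in the same order. *)
Definition residue theta eta (phi : P theta -> P eta) i : 'M[K]_(eta i, theta i) :=
  \matrix_(r, s) vertex_coef pi i (proj_coord r (phi (proj_gen s))).

Lemma residue_vec_linear theta eta (phi : {linear P theta -> P eta}) i v :
  residue_vec i (phi v) = residue phi i *m residue_vec i v.
Proof.
apply/colP => r; rewrite !mxE proj_coord_linearE raddf_sum (bigD1 i) //= addrC.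
rewrite big1 ?add0r => [|j ji].
  rewrite raddf_sum; apply: eq_bigr => s _ /=.
  by rewrite vertex_coefM !mxE mulrC.
rewrite raddf_sum big1 // => s _ /=.
by rewrite vertex_coefM vertex_coef_proj_coord ?mul0r.
Qed.

Lemma residue_comp theta eta zeta (psi : {linear P eta -> P zeta})
    (phi : P theta -> P eta) i :
  residue (psi \o phi) i = residue psi i *m residue phi i.
Proof.
apply/matrixP => r s.
have /colP/(_ r) := residue_vec_linear psi i (phi (proj_gen s)).
rewrite !mxE /= => ->; apply: eq_bigr => t _; by rewrite !mxE.
Qed.

Lemma eq_residue theta eta (phi psi : P theta -> P eta) i :
  phi =1 psi -> residue phi i = residue psi i.
Proof. by move=> E; apply/matrixP => r s; rewrite !mxE E. Qed.

Lemma residueD theta eta (phi psi : P theta -> P eta) i :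
  residue (fun v => phi v + psi v) i = residue phi i + residue psi i.
Proof. by apply/matrixP => r s; rewrite !mxE !raddfD. Qed.

Lemma residueB theta eta (phi psi : P theta -> P eta) i :
  residue (fun v => phi v - psi v) i = residue phi i - residue psi i.
Proof. by apply/matrixP => r s; rewrite !mxE !raddfB. Qed.

Lemma vertex_coef_gen theta i (r s : 'I_(theta i)) :
  vertex_coef pi i (proj_coord r (proj_gen s)) = (r == s)%:R.
Proof.
rewrite proj_coord_gen eq_Tagged /= [s == r]eq_sym.
by case: (r == s); rewrite ?mul1r ?mul0r ?raddf0 // vertex_coef_idem eqxx.
Qed.

Lemma residue_id theta i : residue (@id (P theta)) i = 1%:M.
Proof. by apply/matrixP => r s; rewrite !mxE vertex_coef_gen. Qed.

(** Each application of [w] multiplies the coordinates by elements of the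
    radical, so coordinates of the [m]-th iterate lie in its [m]-th power. *)
Lemma nil_residue theta (w : {linear P theta -> P theta}) :
  (forall i, residue w i = 0) -> exists m, forall v, iter m w v = 0.
Proof.
move=> w0; have [m nil] := radical_nilpotent pi; exists m => v.
apply: proj_coordP => j r; rewrite raddf0; apply: nil.
elim: m j r => [|m IHm] j r /=; first exact: radical_pow0.
rewrite proj_coord_linearE.
apply: big_ind => [||i _]; [exact: radical_pow_0 | exact: radical_powD |].
apply: big_ind => [||s _]; [exact: radical_pow_0 | exact: radical_powD |].
rewrite -addn1; apply: radical_powM => //; apply: radical_pow1 => k.
(* The entry lies in e_i L e_j, so only the case i = j = k is not automatic. *)
have [<-|ki] := eqVneq i k; last first.
  rewrite -proj_gen_idem linearZ proj_coordZ vertex_coefM vertex_coef_idem.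
  by rewrite (negPf ki) mul0r.
have [E|ji] := eqVneq j i; last exact: vertex_coef_proj_coord.
by case: _ / E s => s; have /matrixP/(_ r s) := w0 j; rewrite !mxE.
Qed.

Lemma residue1_bij theta (u : {linear P theta -> P theta}) :
  (forall i, residue u i = 1%:M) ->
  exists2 u' : {linear P theta -> P theta}, cancel u u' & cancel u' u.
Proof.
move=> u1; have [|w wE] := @linear_packed _ (P theta) (P theta) (fun v => v - u v).
  by move=> a x y; rewrite linearP scalerBr opprD addrACA.
have [|m w0] := @nil_residue _ w.
  by move=> i; rewrite (eq_residue _ wE) residueB u1 residue_id subrr.
apply: (@unipotent_bij _ _ _ m) => v; rewrite -[RHS](w0 v).
by apply: eq_iter => {}v; rewrite wE.
Qed.

Section LiftMatrix.
Context (theta : 'I_n -> nat) (h : forall i, 'M[K]_(theta i)).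

(** Scalar matrices at the vertices act on the projective: the section of
    [residue] whose invertible values are the reductive part of the group. *)
Definition mx_lift (v : P theta) : P theta :=
  [ffun i => [ffun r => \sum_s (h i r s)%:A *: v i s]].

Lemma mx_liftE v i r : mx_lift v i r = \sum_s (h i r s)%:A *: v i s.
Proof. by rewrite /mx_lift !ffunE. Qed.

Fact mx_lift_linear : linear mx_lift.
Proof.
move=> a u v; apply/dirsumP => i; apply/ffunP => r; rewrite proj_sumE !mx_liftE.
rewrite scaler_sumr -big_split; apply: eq_bigr => s _ /=.
by rewrite proj_sumE scalerDr !scalerA mulr_algl mulr_algr.
Qed.

HB.instance Definition _ := GRing.isLinear.Build L (P theta) (P theta) *:%R mx_lift
  mx_lift_linear.

Lemma residue_mx_lift i : residue mx_lift i = h i.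
Proof.
apply/matrixP => r s; rewrite mxE /proj_coord mx_liftE.
have -> : left_ideal_val (\sum_t (h i r t)%:A *: proj_gen s i t) =
          \sum_t h i r t *: (proj_coord t (proj_gen s) : L).
  apply: (etrans (raddf_sum (\val : left_ideal (e_ i) -> L^o) _ _ _)); apply: eq_bigr => t _ /=.
  exact: (mulr_algl (h i r t) (proj_coord t (proj_gen s) : L)).
rewrite raddf_sum (bigD1 s) //= linearZ /= vertex_coef_gen eqxx mulr1.
by rewrite big1 ?addr0 // => t /negPf ts; rewrite linearZ /= vertex_coef_gen ts mulr0.
Qed.

End LiftMatrix.

End ProjectiveSums.

(** * Dilations along an idempotent and their conjugates in the reductive part *)

(** Both sides are the determinant of the block matrix with rows [1, - A] and
    [B, 1], computed by clearing the upper right or the lower left block. *)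
Lemma det_1D_mulmxC (F : comPzRingType) (m k : nat) (A : 'M[F]_(m, k)) (B : 'M[F]_(k, m)) :
  \det (1%:M + A *m B) = \det (1%:M + B *m A).
Proof.
pose M := block_mx 1%:M (- A) B 1%:M.
transitivity (\det M).
  have := det_mulmx (block_mx 1%:M A 0 1%:M) M.
  rewrite det_ublock !det1 !mul1r => <-.
  rewrite mulmx_block !mul1mx !mulmx1 !mul0mx !add0r addNr.
  by rewrite det_lblock det1 mulr1.
have := det_mulmx (block_mx 1%:M 0 (- B) 1%:M) M.
rewrite det_lblock !det1 !mul1r => <-.
rewrite mulmx_block !mul1mx !mulmx1 !mul0mx !addr0 addNr.
by rewrite det_ublock det1 mul1r mulNmx mulmxN opprK addrC.
Qed.

(** [A *m B] is an idempotent of rank [k]; its dilation has [k] eigenvalues [t]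
    and otherwise 1. *)
Lemma det_dilation (F : comPzRingType) (m k : nat) (A : 'M[F]_(m, k)) (B : 'M[F]_(k, m)) t :
  B *m A = 1%:M -> \det (1%:M + (t - 1) *: (A *m B)) = t ^+ k.
Proof.
move=> BA; rewrite scalemxAl det_1D_mulmxC -scalemxAr BA.
by rewrite scalemx1 -raddfD addrC subrK det_scalar.
Qed.

Section MatrixLifts.
Context (K : fieldType) (n : nat) (Q : quiver n) (L : falgType K).
Context (pi : presentation Q L).
Local Notation P := (proj_sum pi).
Implicit Types (theta q : 'I_n -> nat).

Lemma mx_liftM theta (h k : forall i, 'M[K]_(theta i)) (v : P theta) :
  mx_lift h (mx_lift k v) = mx_lift (fun i => h i *m k i) v.
Proof.
apply/dirsumP => i; apply/ffunP => r; rewrite !mx_liftE.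
under eq_bigr do rewrite mx_liftE scaler_sumr.
rewrite exchange_big; apply: eq_bigr => s _ /=.
rewrite mxE !scaler_suml; apply: eq_bigr => j _.
by rewrite scalerA mulr_algl scalerA.
Qed.

Lemma eq_mx_lift theta (h k : forall i, 'M[K]_(theta i)) (v : P theta) :
  (forall i, h i = k i) -> mx_lift h v = mx_lift k v.
Proof.
move=> E; apply/dirsumP => i; apply/ffunP => r; rewrite !mx_liftE.
by apply: eq_bigr => s _; rewrite E.
Qed.

(** Two idempotents that agree modulo a nilpotent ideal are conjugate. *)
Lemma idempotent_conj_lift theta (e : {linear P theta -> P theta}) :
  (forall v, e (e v) = e v) ->
  exists u : aut (P theta), forall v, e (u v) = u (mx_lift (residue e) v).
Proof.
move=> ee; pose e' : {linear P theta -> P theta} := mx_lift (residue e).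
have Ree i : residue e i *m residue e i = residue e i.
  by rewrite -residue_comp; apply: eq_residue.
have e'e' v : e' (e' v) = e' v by rewrite /e' /= mx_liftM; apply: eq_mx_lift.
(* The expansion of e e' + (1 - e)(1 - e'). *)
pose u : {linear P theta -> P theta} :=
  ((e \o e') \- e) \+ ((e \o e') \- e') \+ idfun.
have uE v : u v = e (e' v) - e v + (e (e' v) - e' v) + v by [].
have [|u' uK u'K] := @residue1_bij _ _ _ _ pi _ u.
  move=> i; rewrite (@residueD _ _ _ _ _ _ _ (fun v => e (e' v) - e v + (e (e' v) - e' v)) id).
  rewrite (@residueD _ _ _ _ _ _ _ (fun v => e (e' v) - e v)) !residueB.
  rewrite (residue_comp e e') residue_mx_lift Ree residue_id.
  by rewrite !subrr !add0r.
exists (Aut uK u'K) => v; change (e (u v) = u (e' v)); rewrite !uE e'e'.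
by rewrite subrr add0r subrK !linearD !linearN /= !ee subrr addr0 subrK.
Qed.

End MatrixLifts.

Section Dilations.
Context (K : fieldType) (L : falgType K) (M : lmodType L).

(** For an idempotent [e], multiplication by [t] on the image of [e] and by 1 on
    its kernel. *)
Definition dilation (e : M -> M) (t : K) (v : M) : M := v + (t - 1)%:A *: e v.

Lemma dilation_linear (e : {linear M -> M}) t : linear (dilation e t).
Proof.
move=> a u v; rewrite /dilation linearP !scalerDr !scalerA mulr_algl mulr_algr.
by rewrite addrACA.
Qed.

Lemma dilationM (e : {linear M -> M}) t s v : (forall v, e (e v) = e v) ->
  dilation e t (dilation e s v) = dilation e (t * s) v.
Proof.
move=> ee; rewrite /dilation linearD linearZ /= ee -addrA; congr (_ + _).
rewrite scalerDr scalerA mulr_algl scalerA -!scalerDl; congr (_%:A *: _).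
by ring.
Qed.

Lemma dilation_aut (e : {linear M -> M}) t : (forall v, e (e v) = e v) -> t != 0 ->
  exists g : aut M, forall v, g v = dilation e t v.
Proof.
move=> ee t0.
have [g gE] := linear_packed (dilation_linear e t).
have [g' g'E] := linear_packed (dilation_linear e t^-1).
have dil1 v : dilation e 1 v = v by rewrite /dilation subrr scale0r scale0r addr0.
have gK : cancel g g' by move=> v; rewrite g'E gE dilationM // mulVf.
have g'K : cancel g' g by move=> v; rewrite g'E gE dilationM // mulfV.
by exists (Aut gK g'K).
Qed.

End Dilations.

(** * Regular functions and characters *)

Section RegularFunctions.
Context (K : fieldType) (L : falgType K) (M N : lmodType L).

(** Functionals see only the values of a linear map, not the proof of linearity
    bundled with it; take scalar 0 in the definition. *)
Lemma eq_hom_functional (l : {linear M -> N} -> K) (f g : {linear M -> N}) :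
  hom_functional l -> f =1 g -> l f = l g.
Proof.
by move=> lin fg; rewrite (lin 0 f g f) ?mul0r ?add0r // => v; rewrite !scale0r add0r.
Qed.

Lemma eq_regular_on_hom (F : {linear M -> N} -> K) (f g : {linear M -> N}) :
  regular_on_hom F -> f =1 g -> F f = F g.
Proof.
move=> [k [l [p [lin FE]]]] fg; rewrite !FE; apply: mpoly.meval_eq => i.
exact: eq_hom_functional.
Qed.

(** The line through [x] in direction [y] is parametrized so that [t = 1] gives
    [x], to match the action of a one-parameter subgroup. *)
Lemma regular_on_line (F : {linear M -> N} -> K) (x y : {linear M -> N}) :
  regular_on_hom F ->
  exists p : {poly K}, forall (t : K) (h : {linear M -> N}),
    (forall v, h v = (t - 1)%:A *: y v + x v) -> F h = p.[t].
Proof.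
move=> [k [l [p [lin FE]]]].
exists (\sum_(m <- mpoly.msupp p) (mpoly.mcoeff m p)%:P *
          \prod_i ((l i y)%:P * ('X - 1) + (l i x)%:P) ^+ mpoly.fun_of_multinom m i) => t h hE.
rewrite FE mpoly.mevalE horner_sum; apply: eq_bigr => m _.
rewrite !hornerE horner_prod; congr (_ * _); apply: eq_bigr => i _.
by rewrite (lin i _ _ _ _ hE) !hornerE mulrC.
Qed.

Lemma eq_aut_inv (g h : aut M) : g =1 h -> aut_inv g =1 aut_inv h.
Proof. by move=> gh v; rewrite -{1}(aut_invK h v) -gh aut_funK. Qed.

End RegularFunctions.

Section Characters.
Context (K : fieldType) (L : falgType K) (M N : lmodType L).
Local Notation G := (aut M * aut N)%type.
Context (chi : G -> K) (chi_char : character chi).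

Lemma eq_character (g h : G) : g.1 =1 h.1 -> g.2 =1 h.2 -> chi g = chi h.
Proof.
move=> gh1 gh2; have [[k [l [p [lin chiE]]]] _ _] := chi_char.
rewrite !chiE; apply: mpoly.meval_eq => i.
by case: (lin i) => l' lin'; apply: (eq_hom_functional lin') => //; apply: eq_aut_inv.
Qed.

(** The values of [chi] commute and are invertible, so conjugate elements have
    equal values.  The first factor of the group is opposite, so it is the
    inverse of [u1] that conjugates there. *)
Lemma character_conj (g g' : G) (u1 : aut M) (u2 : aut N) :
  (forall v, g.1 (u1 v) = u1 (g'.1 v)) -> (forall v, g.2 (u2 v) = u2 (g'.2 v)) ->
  chi g = chi g'.
Proof.
move=> gu1 gu2; have [_ chi_neq0 chiM] := chi_char.
pose u : G := (Aut (aut_invK u1) (aut_funK u1), u2).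
apply: (mulIf (chi_neq0 u)); rewrite [RHS]mulrC -!chiM; apply: eq_character => v /=.
  by rewrite -{1}(aut_invK u1 v) gu1 aut_funK.
exact: gu2.
Qed.

End Characters.

Section WeightOfDilation.
Context (K : fieldType) (n : nat) (Q : quiver n) (L : falgType K).
Context (pi : presentation Q L).
Local Notation P := (proj_sum pi).
Implicit Types (theta q : 'I_n -> nat).

Lemma dilation_conj_reductive theta q (s : {linear P q -> P theta})
    (r : {linear P theta -> P q}) : cancel s r ->
  exists u : aut (P theta), forall t (g : aut (P theta)), t != 0 ->
    (forall v, g v = dilation (s \o r) t v) ->
    exists g' h, [/\ reductive_elt h g', forall v, g (u v) = u (g' v)
                   & forall i, \det (h i) = t ^+ q i].
Proof.
move=> sK; pose e : {linear P theta -> P theta} := s \o r.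
have ee v : e (e v) = e v by rewrite /e /= sK.
have [u uE] := idempotent_conj_lift ee; exists u => t g t0 gE.
have det_h i : \det (1%:M + (t - 1) *: residue e i) = t ^+ q i.
  rewrite /e /= residue_comp; apply: det_dilation; rewrite -residue_comp.
  by rewrite (@eq_residue _ _ _ _ _ _ _ _ id) ?residue_id.
have e'e' (v : P theta) : mx_lift (residue e) (mx_lift (residue e) v) = mx_lift (residue e) v.
  by rewrite mx_liftM; apply: eq_mx_lift => i; rewrite -residue_comp; apply: eq_residue.
have [g' g'E] := @dilation_aut _ _ (P theta) (mx_lift (residue e)) t e'e' t0.
exists g', (fun i => 1%:M + (t - 1) *: residue e i); split=> [|v|//].
  split=> [i|v i k]; first by rewrite unitmxE det_h unitrX // unitfE.
  rewrite g'E /dilation addrC proj_sumE mx_liftE scaler_sumr addrC.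
  under [RHS]eq_bigr do rewrite !mxE !scalerDl.
  rewrite big_split /=; congr (_ + _).
    rewrite (bigD1 k) //= eqxx !scale1r big1 ?addr0 // => j /negPf jk.
    by rewrite [k == j]eq_sym jk !scale0r.
  by apply: eq_bigr => j _; rewrite !mxE scalerA mulr_algl scalerA.
by rewrite gE g'E /dilation linearD linearZ /= -uE.
Qed.

(** The sign in the pairing comes from acting on the term in degree -1 by the
    inverse parameter. *)
Lemma character_dilation (thm1 th0 qm1 q0 : 'I_n -> nat) chi (dm1 d0 : 'I_n -> int)
    (s1 : {linear P qm1 -> P thm1}) (r1 : {linear P thm1 -> P qm1})
    (s0 : {linear P q0 -> P th0}) (r0 : {linear P th0 -> P q0})
    t (g : aut (P thm1) * aut (P th0)) :
  character chi -> has_weight chi dm1 d0 -> cancel s1 r1 -> cancel s0 r0 -> t != 0 ->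
  (forall v, g.1 v = dilation (s1 \o r1) t^-1 v) ->
  (forall v, g.2 v = dilation (s0 \o r0) t v) ->
  chi g = t ^ weight_pairing qm1 q0 dm1 d0.
Proof.
move=> chi_char chi_wt s1K s0K t0 g1E g2E.
have [u1 u1P] := dilation_conj_reductive s1K.
have [u2 u2P] := dilation_conj_reductive s0K.
have [g1' [h1 [red1 conj1 det1]]] := u1P t^-1 g.1 (invr_neq0 t0) g1E.
have [g2' [h2 [red2 conj2 det2]]] := u2P t g.2 t0 g2E.
rewrite (character_conj chi_char (g' := (g1', g2')) conj1 conj2).
rewrite (chi_wt h1 h2) // /weight_pairing.
rewrite -sumrN -big_split /= (big_morph (exprz t) (fun a b => expfzDr a b t0) (expr0z t)).
apply: eq_bigr => i _; rewrite det1 det2 expfzDr //; congr (_ * _).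
  exact: etrans (exprz_exp t^-1 (Posz _) _) (exprz_inv _ _).
exact: (exprz_exp t (Posz _) _).
Qed.

End WeightOfDilation.

(** * Splitting of inflations *)

(** Lifting the images of the standard basis of a free module that retracts onto
    [C] gives a section of [g]; subtracting it lands in the image of [f]. *)
Lemma short_exact_retract (A : pzRingType) (M N C : lmodType A)
    (f : {linear M -> N}) (g : {linear N -> C}) :
  fg_projective C -> short_exact f g -> exists r : {linear N -> M}, cancel f r.
Proof.
move=> [k [s [p sK]]] [f_inj ker_g g_surj].
have [b bP] : exists b : 'I_k -> N, forall j, g (b j) = p (delta_mx 0 j).
  by apply: (fin_all_exists (fun j => g_surj _)).
pose sec c := \sum_j s c 0 j *: b j.
have sec_lin : linear sec.
  move=> a c d; rewrite /sec linearP scaler_sumr -big_split; apply: eq_bigr => j _ /=.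
  by rewrite !mxE scalerDl scalerA.
have secK c : g (sec c) = c.
  rewrite /sec linear_sum -[RHS]sK [in RHS](row_sum_delta (s c)) linear_sum.
  by apply: eq_bigr => j _; rewrite !linearZ bP.
have in_im v : exists a, f a == v - sec (g v).
  have [|a fa] := (ker_g (v - sec (g v))).1; first by rewrite linearB secK subrr.
  by exists a; rewrite fa.
pose r v := xchoose (in_im v).
have rP v : f (r v) = v - sec (g v) by apply/eqP/(xchooseP (in_im v)).
have r_lin : linear r.
  move=> a u v; apply: f_inj; rewrite linearP !rP linearP sec_lin.
  by rewrite scalerBr opprD addrACA.
have [r' r'E] := linear_packed r_lin; exists r' => v; rewrite r'E.
apply: f_inj; rewrite rP (_ : g (f v) = 0); last by apply/ker_g; exists v.
by rewrite /sec linear0 big1 ?subr0 // => j _; rewrite mxE scale0r.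
Qed.

(** * Polynomiality along one-parameter subgroups *)

Lemma dilation_id (F : fieldType) (A : falgType F) (M : lmodType A) t (v : M) :
  dilation (idfun \o idfun) t v = t%:A *: v.
Proof.
by rewrite /dilation /= -{1}[v]scale1r -scalerDl -[X in X + _]scale1r -scalerDl addrC subrK.
Qed.

Lemma poly_nonzero_root0 (F : numDomainType) (p : {poly F}) :
  (forall t, t != 0 -> p.[t] = 0) -> p = 0.
Proof.
move=> p0; pose rs : seq F := [seq i.+1%:R | i <- iota 0 (size p)].
apply: (@roots_geq_poly_eq0 _ _ rs).
- by apply/allP => _ /mapP[i _ ->]; rewrite /root p0 // pnatr_eq0.
- by rewrite map_inj_uniq ?iota_uniq // => i j /eqP; rewrite eqr_nat => /eqP[].
- by rewrite size_map size_iota.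
Qed.

(** If [k = - j < 0], the polynomial ['X^j * p - c] vanishes at all [t != 0],
    hence identically; its value at 0 is [- c]. *)
Lemma monomial_poly_ge0 (F : numFieldType) (c : F) (p : {poly F}) (k : int) :
  c != 0 -> (forall t, t != 0 -> t ^ k * c = p.[t]) -> 0 <= k.
Proof.
case: k => // j c0 pE.
have q0 : 'X^(j.+1) * p - c%:P = 0.
  apply: poly_nonzero_root0 => t t0; rewrite !hornerE -pE // NegzE.
  by rewrite mulrA -exprnN mulfV ?expf_neq0 // mul1r subrr.
move/(congr1 (horner^~ 0)): q0; rewrite !hornerE expr0n mul0r sub0r => /eqP.
by rewrite oppr_eq0 (negPf c0).
Qed.

Section Semistability.
Context (F : numFieldType) (n : nat) (Q : quiver n) (L : falgType F).
Context (pi : presentation Q L).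
Local Notation P := (proj_sum pi).
Context (thm1 th0 : 'I_n -> nat) (x : {linear P thm1 -> P th0}).
Context (chi : aut (P thm1) * aut (P th0) -> F) (dm1 d0 : 'I_n -> int).
Context (chi_char : character chi) (chi_wt : has_weight chi dm1 d0).
Context (x_ss : semistable chi x).

(** The dilation of [x] along a subobject stays on a line through [x]. *)
Lemma split_subobject_weight_ge0 (qm1 q0 : 'I_n -> nat)
    (s1 : {linear P qm1 -> P thm1}) (r1 : {linear P thm1 -> P qm1})
    (s0 : {linear P q0 -> P th0}) (r0 : {linear P th0 -> P q0}) :
  cancel s1 r1 -> cancel s0 r0 -> (forall v, exists w, x (s1 v) = s0 w) ->
  0 <= weight_pairing qm1 q0 dm1 d0.
Proof.
move=> s1K s0K stable; have [m [f [m_gt0 [f_reg f_semi] fx]]] := x_ss.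
pose y : {linear P thm1 -> P th0} := (s0 \o (r0 \o x)) \- (x \o (s1 \o r1)).
have [p pE] := regular_on_line x y f_reg.
rewrite -(@pmulr_lge0 _ m%:Z) //; apply: (monomial_poly_ge0 fx (p := p)) => t t0.
have e1e1 v : (s1 \o r1) ((s1 \o r1) v) = (s1 \o r1) v by rewrite /= s1K.
have e0e0 v : (s0 \o r0) ((s0 \o r0) v) = (s0 \o r0) v by rewrite /= s0K.
have [g1 g1E] := dilation_aut (e := s1 \o r1) e1e1 (invr_neq0 t0).
have [g2 g2E] := dilation_aut (e := s0 \o r0) e0e0 t0.
rewrite -(pE t (grp_act (g1, g2) x)) => [|v].
  rewrite f_semi (character_dilation (g := (g1, g2)) chi_char chi_wt s1K s0K t0 g1E g2E).
  by rewrite -exprz_exp.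
rewrite /= g2E g1E /dilation /=.
have [w xw] := stable (r1 v).
rewrite linearD linearZ /= xw !linearD !linearZ /= s0K.
rewrite [RHS]addrC -addrA; congr (_ + _).
rewrite scalerDr scalerBr addrCA; congr (_ + _).
rewrite scalerA mulr_algl scalerA -!scaleNr -!scalerDl; congr (_%:A *: _).
(* (t^-1 - 1) + (t - 1) (t^-1 - 1) = t (t^-1 - 1) = - (t - 1) *)
by field.
Qed.

(** [X] is a subobject of itself, which gives one inequality.  Its dilations fix
    [x], so the semi-invariant is constant along them also when [t] is replaced
    by [t^-1], which gives the other. *)
Lemma total_weight0 : weight_pairing thm1 th0 dm1 d0 = 0.
Proof.
apply/eqP; rewrite Order.POrderTheory.eq_le; apply/andP; split; last first.
  by apply: (@split_subobject_weight_ge0 thm1 th0 idfun idfun idfun idfun) => // v; exists (x v).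
rewrite -oppr_ge0; have [m [f [m_gt0 [f_reg f_semi] fx]]] := x_ss.
rewrite -(@pmulr_lge0 _ m%:Z) //; apply: (monomial_poly_ge0 fx (p := (f x)%:P)) => t t0.
have [g1 g1E] := dilation_aut (e := idfun \o (idfun : P thm1 -> P thm1)) (fun=> erefl) t0.
have [g2 g2E] :=
  dilation_aut (e := idfun \o (idfun : P th0 -> P th0)) (fun=> erefl) (invr_neq0 t0).
have chi_g : chi (g1, g2) = t ^ - weight_pairing thm1 th0 dm1 d0.
  rewrite -exprz_inv; apply:
    (@character_dilation _ _ _ _ _ _ _ _ _ _ _ _ idfun idfun idfun idfun) => //.
    by rewrite invr_neq0.
  by move=> v; rewrite invrK g1E.
rewrite hornerC -exprz_exp -chi_g -[LHS]f_semi; apply: (eq_regular_on_hom f_reg) => v.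
rewrite /= g2E g1E !dilation_id linearZ /= scalerA mulr_algl scalerA.
by rewrite mulVf // scale1r scale1r.
Qed.

End Semistability.

Theorem proposition4p2 (R : realType) (n : nat) (Q : quiver n) (L : falgType R[i])
    (pi : presentation Q L) (thm1 th0 : 'I_n -> nat)
    (x : {linear proj_sum pi thm1 -> proj_sum pi th0})
    (chi : aut (proj_sum pi thm1) * aut (proj_sum pi th0) -> R[i])
    (dm1 d0 : 'I_n -> int) :
  character chi -> has_weight chi dm1 d0 ->
  semistable chi x ->
  weight_pairing thm1 th0 dm1 d0 = 0 /\
  (forall (Y : two_term L) (f : two_term_hom Y (two_term_of x)),
     inflation f ->
     forall qm1 q0 : 'I_n -> nat,
       proj_class pi (term_m1 Y) qm1 -> proj_class pi (term_0 Y) q0 ->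
       0 <= weight_pairing qm1 q0 dm1 d0).
Proof.
move=> chi_char chi_wt x_ss; split; first exact: total_weight0 chi_char chi_wt x_ss.
move=> Y f [Z [g [exact_m1 exact_0]]] qm1 q0.
move=> [phi1 [phi1' phi1K phi1'K]] [phi0 [phi0' phi0K phi0'K]].
have [r1 r1K] := short_exact_retract (term_m1_proj Z) exact_m1.
have [r0 r0K] := short_exact_retract (term_0_proj Z) exact_0.
have [psi1 psi1E] := linear_inverse phi1K phi1'K.
have [psi0 psi0E] := linear_inverse phi0K phi0'K.
apply: (split_subobject_weight_ge0 chi_char chi_wt x_ss
  (s1 := hom_m1 f \o psi1) (r1 := phi1 \o r1) (s0 := hom_0 f \o psi0) (r0 := phi0 \o r0)).
- by move=> v; rewrite /= r1K psi1E phi1'K.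
- by move=> v; rewrite /= r0K psi0E phi0'K.
move=> v; exists (phi0 (tdiff Y (psi1 v))).
by rewrite /= psi0E phi0K; apply: esym; apply: (hom_comm f).
Qed.
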